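(* Let $\mathbb{X}$ be a finite-dimensional (real) normed space, let $\{A_1,\dots,A_m\}$ be a collection of finitely many closed sets in $\mathbb{X}$ and let $\bar x\in A:=\bigcap_{i=1}^mA_i$. Suppose that $\{A_1,\dots,A_m\}$ is subtransversal at $\bar x$. Then there exist $\tau,\delta\in(0,+\infty)$ such that $$N(A,x)\cap\mathbf{B}_{\mathbb{X}^*}\subseteq\tau\sum_{i=1}^m\big(N(A_i,x)\cap\mathbf{B}_{\mathbb{X}^*}\big)$$ holds for all $x\in\mathbf{B}(\bar x,\delta)\cap A$.
   Context: $\mathbb{X}^*$ is the dual of $\mathbb{X}$; $\mathbf{B}_{\mathbb{X}^*}$ is the closed unit ball of $\mathbb{X}^*$; $\mathbf{B}(x,r)$ is the open ball in $\mathbb{X}$ with center $x$ and radius $r$; $\mathbf{d}(x,S)=\inf_{y\in S}\|x-y\|$. For a closed set $A\subseteq\mathbb{X}$, $x\in A$ and $\varepsilon\ge0$, the set of $\varepsilon$-normals is $\hat N_\varepsilon(A,x)=\{x^*\in\mathbb{X}^*:\limsup_{y\to x,\,y\in A}\frac{\langle x^*,y-x\rangle}{\|y-x\|}\le\varepsilon\}$, and $\hat N(A,x)=\hat N_0(A,x)$ is the Fréchet normal cone. The limiting (Mordukhovich) normal cone $N(A,x)$ is the set of all $x^*\in\mathbb{X}^*$ for which there are sequences $x_n\to x$ with $x_n\in A$, $\varepsilon_n\ge0$ with $\varepsilon_n\to0$, and $x_n^*\to x^*$ weak$^*$ with $x_n^*\in\hat N_{\varepsilon_n}(A,x_n)$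 for all $n$. (In Asplund spaces, in particular in finite dimensions, one may equivalently take $\varepsilon_n=0$.) The collection $\{A_1,\dots,A_m\}$ is subtransversal at $\bar x\in A$ if there exist $\tau,r\in(0,+\infty)$ such that $\mathbf{d}(x,A)\le\tau\sum_{i=1}^m\mathbf{d}(x,A_i)$ for all $x\in\mathbf{B}(\bar x,r)$. *)

(* Defs.v *)
From HB Require Import structures.
From mathcomp Require Import all_boot all_order all_algebra.
From mathcomp Require Import all_classical all_reals all_analysis.

Set Implicit Arguments.
Unset Strict Implicit.
Unset Printing Implicit Defensive.

Import Order.TTheory GRing.Theory Num.Theory.
Import numFieldNormedType.Exports.

Local Open Scope classical_set_scope.
Local Open Scope ring_scope.

Section Spaces.
Context {R : realType}.

Definition finite_dimensional (V : lmodType R) : Prop :=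
  exists (n : nat) (e : 'I_n -> V),
    forall v : V, exists c : 'I_n -> R, v = \sum_(i < n) c i *: e i.

Definition minkowski_sum (W : lmodType R) (m : nat) (S : 'I_m -> set W) : set W :=
  [set \sum_(i < m) y i | y in [set y : 'I_m -> W | forall i, S i (y i)]].

Definition scale_set (W : lmodType R) (t : R) (S : set W) : set W :=
  [set t *: w | w in S].

End Spaces.

Section Normals.
Context {R : realType} {V : normedModType R}.

(* The dual is a subset of the module of all functions V -> R, so that sums and
   scalar multiples of functionals are the pointwise ones. *)
Definition dual : set (V -> R^o) :=
  [set f | linear f /\ continuous f].

Definition dual_norm (f : V -> R^o) : \bar R :=
  ereal_sup [set `|f v|%:E | v in [set v : V | `|v| <= 1]].

Definition dual_unit_ball : set (V -> R^o) :=
  [set f | dual f /\ (dual_norm f <= 1)%E].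

(* The weak-star topology is that of pointwise convergence. *)
Definition weak_star_cvg (u : nat -> V -> R^o) (f : V -> R^o) : Prop :=
  forall v : V, u n v @[n --> \oo] --> f v.

(* Only meaningful for nonempty S. *)
Definition dist_to (x : V) (S : set V) : R := inf [set `|x - y| | y in S].

(* The upper limit is over y in A tending to x with y != x; it is -oo when x is
   isolated in A. *)
Definition eps_normals (eps : R) (A : set V) (x : V) : set (V -> R^o) :=
  [set f | dual f /\
    (limf_esup (fun y : V => (f (y - x) / `|y - x|)%:E) (within A x^')
       <= eps%:E)%E].

Definition limiting_normals (A : set V) (x : V) : set (V -> R^o) :=
  [set f | dual f /\
    exists (xs : nat -> V) (eps : nat -> R) (fs : nat -> V -> R^o),
      [/\ (forall n, A (xs n)) /\ xs @ \oo --> x,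
          (forall n, 0 <= eps n) /\ eps @ \oo --> 0,
          weak_star_cvg fs f &
          forall n, eps_normals (eps n) A (xs n) (fs n)]].

Definition subtransversal (m : nat) (A : 'I_m -> set V) (xbar : V) : Prop :=
  exists tau r : R, [/\ 0 < tau, 0 < r &
    forall x : V, ball xbar r x ->
      dist_to x (\bigcap_i A i) <= tau * \sum_(i < m) dist_to x (A i)].

End Normals.

(* Main.v *)
Require Import Defs.
From HB Require Import structures.
From mathcomp Require Import all_boot all_order all_algebra.
From mathcomp Require Import all_classical all_reals all_analysis.
From mathcomp Require Import ring lra.
Import Order.TTheory GRing.Theory Num.Theory.
Import numFieldNormedType.Exports.
Local Open Scope classical_set_scope.
Local Open Scope ring_scope.

(* Let f be an e-normal to the intersection at a point x. Subtransversality turns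
   exact penalisation into the statement that
     (y, a) |-> - f (y - x) + K * sum_i |y - a_i| + e' * |y - x|,  a_i in A_i,
   has a strict local minimum at (x, ..., x). All norms are equivalent, so |.| may
   be taken Euclidean and smoothed to h_s(v) = sqrt(<v, v> + s^2). For small s the
   smoothed function attains its minimum near (x, ..., x), with stationarity
   conditions: w_i := K (y - a_i) / h_s(y - a_i) is a proximal normal to A_i at a_i
   of norm at most K, and sum_i w_i differs from f by O(e'). No fuzzy sum rule is
   needed. Compactness then yields, along a common subsequence, limits w_i in
   N(A_i, x) with f = sum_i w_i and a bound independent of x. *)

(** * Finite-dimensional spaces: bases, compact balls, inner products *)

(** A spanning family of least size is free: a nontrivial relation would express one vector through
    the others, and that vector could be dropped. *)
Lemma finite_dimensional_free (R : realType) (V : lmodType R) :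
  finite_dimensional V ->
  exists (n : nat) (e : 'I_n -> V),
    (forall v, exists c : 'I_n -> R, v = \sum_i c i *: e i) /\
    (forall c : 'I_n -> R, \sum_i c i *: e i = 0 -> forall i, c i = 0).
Proof.
move=> [N [e0 e0P]].
pose spans n := exists e : 'I_n -> V,
  forall v, exists c : 'I_n -> R, v = \sum_i c i *: e i.
have exN : exists n, `[< spans n >] by exists N; apply/asboolP; exists e0.
have [n /asboolP[e eP] nmin] := ex_minnP exN.
exists n, e; split=> // c c0 j; apply/eqP/negPn/negP => cj0.
case: n e eP nmin c c0 j cj0 => [|n] e eP nmin c c0 j cj0; first by case: j cj0.
have /nmin : `[< spans n >]; last by rewrite ltnn.
apply/asboolP; exists (e \o lift j) => v.
have ej : e j = \sum_(i < n) (- (c j)^-1 * c (lift j i)) *: e (lift j i).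
  move: c0; rewrite (bigD1_ord j)//= => /eqP; rewrite addr_eq0 => /eqP cej.
  rewrite -[LHS]scale1r -(mulVf cj0) -scalerA cej scalerN scaler_sumr -sumrN.
  by apply: eq_bigr => i _; rewrite scalerA mulNr scaleNr.
have [b ->] := eP v.
exists (fun i => b j * (- (c j)^-1 * c (lift j i)) + b (lift j i)).
rewrite (bigD1_ord j)//= {1}ej scaler_sumr -big_split/=.
by apply: eq_bigr => i _; rewrite scalerDl !scalerA.
Qed.

Section Coordinates.
Context (R : realType) (V : normedModType R).

Lemma continuous_comb n (e : 'I_n -> V) :
  continuous (fun a : 'rV[R]_n => \sum_i a ord0 i *: e i).
Proof.
apply: continuous_big => [|i _ a]; first exact: add_continuous.
apply: (@continuousZ _ _ _ (fun a : 'rV[R]_n => a ord0 i) (fun=> e i)).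
  exact: coord_continuous.
exact: cst_continuous.
Qed.

(** Uniqueness of coordinates in a basis makes them linear. For the bound, [|L a|] attains its
    minimum on the compact unit sphere of coordinate vectors; freeness makes this minimum positive,
    and homogeneity extends the estimate to all vectors. *)
Lemma bounded_coordinates : finite_dimensional V ->
  exists (n : nat) (e : 'I_n -> V) (c : 'I_n -> {linear V -> R^o}) (C : R),
    [/\ 0 < C, forall v, v = \sum_i c i v *: e i &
        forall i v, `|c i v| <= C * `|v|].
Proof.
move=> /finite_dimensional_free[n [e [espan efree]]].
have [c cP] := choice espan.
have cuniq v b : v = \sum_i b i *: e i -> c v = b.
  move=> vb; apply/funext => i; apply/eqP; rewrite -subr_eq0; apply/eqP.
  apply: (efree (fun i => c v i - b i)).
  under eq_bigr do rewrite scalerBl.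
  by rewrite big_split/= sumrN -cP -vb subrr.
have clin i : linear (fun v => c v i : R^o).
  move=> a u v; rewrite (cuniq _ (fun i => a * c u i + c v i))//.
  rewrite {1}(cP u) {1}(cP v) scaler_sumr -big_split/=.
  by apply: eq_bigr => k _; rewrite scalerDl scalerA.
pose cl i : {linear V -> R^o} :=
  HB.pack (fun v => c v i : R^o) (GRing.isLinear.Build _ _ _ _ _ (clin i)).
pose L (a : 'rV[R]_n) := \sum_i a ord0 i *: e i.
have LZ t a : L (t *: a) = t *: L a.
  by rewrite /L scaler_sumr; apply: eq_bigr => i _; rewrite mxE scalerA.
pose S := [set a : 'rV[R]_n | `|a| = 1].
have [C [C0 CP]] : exists C : R, 0 < C /\ forall a, `|a| <= C * `|L a|.
  have nS (a : 'rV[R]_n) : a != 0 -> S (`|a|^-1 *: a).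
    move=> a0; rewrite /S/= normrZ ger0_norm ?invr_ge0//.
    by rewrite mulVf ?normr_eq0.
  (* The sphere is empty when [n = 0]; then [a = 0] is the only coordinate vector and any constant
     works. *)
  have [[a0 Sa0]|S0] := pselect (S !=set0); last first.
    exists 1; split=> // a; have [->|/nS Sa] := eqVneq a 0.
      by rewrite normr0 mul1r.
    by exfalso; apply: S0; exists (`|a|^-1 *: a).
  have Scomp : compact S.
    apply: bounded_closed_compact.
      by exists 1; split=> // x x1 a /= ->; exact: ltW.
    have -> : S = (fun a : 'rV[R]_n => `|a|) @^-1` [set 1] by [].
    apply: closed_comp => [? _|]; first exact: norm_continuous.
    exact: closed_eq.
  have [||b bS bmin] := @EVT_min_rV R n (fun a => `|L a|) S _ Scomp.
  - by exists a0.
  - apply: continuous_subspaceT => a.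
    by apply: continuous_comp; [exact: continuous_comb|exact: norm_continuous].
  rewrite inE in bS.
  have Lb0 : 0 < `|L b|.
    rewrite normr_gt0; apply/eqP => /efree b0.
    have : b = 0 by apply/rowP => i; rewrite b0 mxE.
    by move=> bE; move: bS; rewrite /S/= bE normr0 => /eqP; rewrite eq_sym oner_eq0.
  exists `|L b|^-1; split; first by rewrite invr_gt0.
  move=> a; have [->|a1] := eqVneq a 0.
    by rewrite normr0 mulr_ge0// invr_ge0.
  have := bmin (`|a|^-1 *: a); rewrite inE => /(_ (nS _ a1)).
  rewrite LZ normrZ ger0_norm ?invr_ge0// ler_pdivlMl ?normr_gt0// => ba.
  by rewrite ler_pdivlMl// mulrC.
exists n, e, cl, C; split=> // i v.
have := CP (\row_i c v i).
have -> : L (\row_i c v i) = v.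
  by rewrite {2}(cP v); apply: eq_bigr => k _; rewrite mxE.
apply: le_trans; rewrite [leRHS]/Num.Def.normr /= mx_normrE.
by apply/bigmax_geP; right => /=; exists (ord0, i) => //=; rewrite mxE.
Qed.

(** Bounded coordinates place the ball inside the continuous image of a compact box, where it is a
    closed subset. *)
Lemma closed_ball_compact x r : finite_dimensional V ->
  compact [set y : V | `|y - x| <= r].
Proof.
move=> /bounded_coordinates[n [e [c [C [C0 vE cC]]]]].
pose M := C * (r + `|x|).
pose K := [set a : 'rV[R]_n | forall i, `[(- M), M]%classic (a ord0 i)].
have Kc : compact K.
  by apply: (@rV_compact _ _ (fun=> `[(- M), M]%classic)) => _; exact: segment_compact.
have LK : compact ((fun a : 'rV[R]_n => \sum_i a ord0 i *: e i) @` K).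
  apply: continuous_compact => //.
  by apply: continuous_subspaceT => a; exact: continuous_comb.
apply: subclosed_compact LK _.
  have -> : [set y : V | `|y - x| <= r] =
    (fun y => `|y - x|) @^-1` [set t | t <= r] by [].
  apply: closed_comp => [y _|]; last exact: closed_le.
  apply: cvg_norm; apply: cvgB => //; exact: cvg_cst.
move=> y /= yx; exists (\row_i c i y).
  move=> i /=; rewrite mxE in_itv/= -ler_norml (le_trans (cC _ _))//.
  rewrite /M ler_pM2l// -[y](subrK x) (le_trans (ler_normD _ _))// lerD2r.
  exact: yx.
by rewrite [RHS]vE; apply: eq_bigr => i _; rewrite mxE.
Qed.

(** [B] is the inner product for which the chosen basis is orthonormal. The last two clauses say
    that its norm is equivalent to the given one, with a single constant for both directions. *)
Lemma exists_inner_product : finite_dimensional V ->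
  exists (B : V -> {linear V -> R^o}) (C : R),
    [/\ 0 < C, forall v w, B v w = B w v,
        forall v, B v v <= (C * `|v|) ^+ 2 &
        forall v, `|v| ^+ 2 <= C ^+ 2 * B v v].
Proof.
move=> /bounded_coordinates[n [e [c [C [C0 vE cC]]]]].
have Blin v : linear (fun w => \sum_i c i v * c i w : R^o).
  move=> a u w; rewrite scaler_sumr -big_split/=; apply: eq_bigr => i _.
  by rewrite linearP/= mulrDr; congr (_ + _); rewrite mulrCA.
pose B v : {linear V -> R^o} :=
  HB.pack (fun w => \sum_i c i v * c i w : R^o) (GRing.isLinear.Build _ _ _ _ _ (Blin v)).
have BE v : B v v = \sum_i c i v ^+ 2.
  by apply: eq_bigr => i _; rewrite expr2.
have B0 v : 0 <= B v v by rewrite BE sumr_ge0// => i _; rewrite sqr_ge0.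
pose E := \sum_i `|e i|.
have E0 : 0 <= E by rewrite sumr_ge0.
(* The first summand serves the upper bound on [B v v], the second the bound on [|v|] by the
   triangle inequality in the basis. Taking [n.+1] keeps [D] positive even when [n = 0]. *)
pose D := C * n.+1%:R + E.
have D0 : 0 < D by rewrite ltr_wpDr// mulr_gt0.
exists B, D; split=> //.
- by move=> v w; apply: eq_bigr => i _; rewrite mulrC.
- move=> v; rewrite BE (@le_trans _ _ (\sum_(i < n) (C * `|v|) ^+ 2))//.
    apply: ler_sum => i _; rewrite -[leLHS]real_normK ?num_real// ler_sqr ?nnegrE//.
    by rewrite mulr_ge0// ltW.
  rewrite sumr_const card_ord (@le_trans _ _ ((C * n.+1%:R * `|v|) ^+ 2))//.
    rewrite mulrAC [leRHS]exprMn -[leLHS]mulr_natr ler_wpM2l ?sqr_ge0//.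
    by rewrite -natrX ler_nat expnS expn1 (leq_trans (leqnSn n))// leq_pmull.
  rewrite ler_sqr ?nnegrE ?mulr_ge0// ?(ltW C0) ?(ltW D0)//.
  by rewrite ler_wpM2r// lerDl.
- move=> v; rewrite -(sqr_sqrtr (B0 v)) -exprMn ler_sqr ?nnegrE;
    rewrite ?mulr_ge0 ?sqrtr_ge0 ?(ltW D0)//.
  apply: (@le_trans _ _ (E * Num.sqrt (B v v))); last first.
    by rewrite ler_wpM2r ?sqrtr_ge0// lerDr mulr_ge0// ltW.
  rewrite {1}(vE v) (le_trans (ler_norm_sum _ _ _))// mulr_suml.
  apply: ler_sum => i _; rewrite normrZ mulrC ler_wpM2l//.
  rewrite -sqrtr_sqr ler_wsqrtr// BE (bigD1 i)//= lerDl.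
  by rewrite sumr_ge0// => j _; rewrite sqr_ge0.
Qed.
End Coordinates.

(** * Lipschitz functions, distances and exact penalisation *)

Lemma lipschitz_continuous (R : realType) (V : normedModType R) (f : V -> R) (M : R) :
  (forall u v, f u <= f v + M * `|u - v|) -> continuous f.
Proof.
move=> fM v; apply/cvgrPdist_le => eps eps0.
have M0 : 0 < `|M| + 1 by rewrite ltr_wpDl.
near=> u.
have uv : (`|M| + 1) * `|u - v| <= eps.
  rewrite mulrC -ler_pdivlMr// distrC ltW//; near: u.
  have := nbhsx_ballx v _ (divr_gt0 eps0 M0); rewrite -ball_normE/=.
  exact.
have Mle (w : V) : M * `|w| <= (`|M| + 1) * `|w|.
  by rewrite ler_wpM2r// (le_trans (ler_norm M))// lerDl.
rewrite ler_distlC; apply/andP; split.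
  by rewrite lerBlDr (le_trans (fM v u))// lerD2l distrC (le_trans (Mle _)).
by rewrite (le_trans (fM u v))// lerD2l (le_trans (Mle _)).
Unshelve. all: by end_near. Qed.

Lemma dist_to_le (R : realType) (V : normedModType R) (y z : V) (S : set V) :
  S z -> dist_to y S <= `|y - z|.
Proof.
move=> Sz; apply: ge_inf; last by exists z.
by exists 0 => _ [w _ <-].
Qed.

Lemma dist_to_approx (R : realType) (V : normedModType R) (y : V) (S : set V) (e : R) :
  S !=set0 -> 0 < e -> exists2 z, S z & `|y - z| < dist_to y S + e.
Proof.
move=> [z0 Sz0] e0.
have [|_ [z Sz <-] ze] := @inf_adherent R [set `|y - z| | z in S] e e0.
  by split; [exists `|y - z0|, z0|exists 0 => _ [w _ <-]].
by exists z.
Qed.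

(** Replace [y] by a nearly closest point [z] of the intersection and split [f (y - x)] as
    [f (y - z) + f (z - x)]. The first term costs [2 * |y - z|], and passing from [eps * |z - x|] to
    [eps * |y - x|] costs at most one more [|y - z|], whence the factor 3. Subtransversality bounds
    [|y - z|]. *)
Lemma subtransversal_penalty (R : realType) (V : normedModType R) (m : nat)
    (A : 'I_m -> set V) (x : V) (f : {linear V -> R^o}) (tau r rho eps : R) :
  (\bigcap_i A i) x -> 0 <= tau -> 0 <= eps <= 1 ->
  (forall y, `|y - x| < r ->
     dist_to y (\bigcap_i A i) <= tau * \sum_(i < m) dist_to y (A i)) ->
  (forall v, `|f v| <= 2 * `|v|) ->
  (forall z, (\bigcap_i A i) z -> `|z - x| < rho ->
     f (z - x) <= eps * `|z - x|) ->
  forall (y : V) (a : 'I_m -> V), `|y - x| < r -> 2 * `|y - x| < rho ->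
    (forall i, A i (a i)) ->
    f (y - x) <= 3 * tau * \sum_i `|y - a i| + eps * `|y - x|.
Proof.
move=> Ax tau0 /andP[eps0 eps1] subt f2 fn y a yr yrho Aa.
apply/ler_addgt0Pr => e e0.
(* The error [t] is multiplied by 3 in the end. The second bound gives [|z - x| < rho], since the
   distance from [y] to the intersection is at most [|y - x|]. *)
pose t := Num.min (e / 3) (rho - 2 * `|y - x|).
have t0 : 0 < t by rewrite lt_min subr_gt0 yrho andbT divr_gt0.
have [|z Az yz] := dist_to_approx _ _ y (\bigcap_i A i) t _ t0; first by exists x.
have yxd := dist_to_le _ _ y _ _ Ax.
have dA : dist_to y (\bigcap_i A i) <= tau * \sum_i `|y - a i|.
  rewrite (le_trans (subt _ yr))// ler_wpM2l//.
  by apply: ler_sum => i _; exact: dist_to_le.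
have zx : `|z - x| <= `|y - z| + `|y - x|.
  by rewrite -[z - x](subrKA y) (distrC y z) ler_normD.
have te : t <= e / 3 by rewrite ge_min lexx.
have tr : t <= rho - 2 * `|y - x| by rewrite ge_min lexx orbT.
have /(fn _ Az) fz : `|z - x| < rho by lra.
have fyz := le_trans (ler_norm _) (f2 (y - z)).
have -> : f (y - x) = (f (y - z) + f (z - x) : R).
  by rewrite -linearD/= subrKA.
have : eps * `|z - x| <= `|y - z| + eps * `|y - x|.
  rewrite (le_trans (ler_wpM2l eps0 zx))// mulrDr lerD2r.
  by rewrite ler_piMl.
rewrite -mulrA; move: fz fyz yz te dA; set fz := f (z - x); set fy := f (y - z).
rewrite /=; move: (tau * _) => T; lra.
Qed.

Lemma continuous_combination (R : realType) (T : topologicalType) (m : nat)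
    (g k : T -> R) (G : 'I_m -> T -> R) (a b : R) :
  continuous g -> continuous k -> (forall i, continuous (G i)) ->
  continuous (fun z => - g z + a * (\sum_i G i z) + b * k z).
Proof.
move=> gc kc Gc z; apply: cvgD; [apply: cvgD|].
- by apply: cvgN; exact: gc.
- apply: cvgM; first exact: cvg_cst.
  apply: cvg_big => [|i _]; first exact: add_continuous.
  exact: Gc.
- by apply: cvgM; [exact: cvg_cst|exact: kc].
Qed.

Lemma continuous_compB (R : realType) (V : normedModType R) (T : topologicalType)
    (g g' : T -> V) (k : V -> R) : continuous g -> continuous g' -> continuous k ->
  continuous (fun z => k (g z - g' z)).
Proof.
move=> gc g'c kc z; apply: (@continuous_comp _ _ _ (fun z => g z - g' z) k).
  by apply: cvgB; [exact: gc|exact: g'c].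
exact: kc.
Qed.

(** * The Euclidean norm and its smoothing *)

Section Inner.
Context (R : realType) (V : normedModType R).
Variables (B : V -> {linear V -> R^o}) (C : R).
Hypotheses (C0 : 0 < C) (Bsym : forall v w, B v w = B w v).
Hypotheses (B_le : forall v, B v v <= (C * `|v|) ^+ 2)
  (le_B : forall v, `|v| ^+ 2 <= C ^+ 2 * B v v).

Lemma inner_ge0 v : 0 <= B v v.
Proof.
by have := le_trans (sqr_ge0 `|v|) (le_B v); rewrite pmulr_rge0 ?exprn_gt0.
Qed.

Lemma inner_addl u v w : B (u + v) w = B u w + B v w.
Proof. by rewrite !(Bsym _ w) linearD. Qed.

Lemma inner_subl u v w : B (u - v) w = B u w - B v w.
Proof. by rewrite !(Bsym _ w) linearB. Qed.

Lemma inner_scalel a v w : B (a *: v) w = a * B v w.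
Proof. by rewrite !(Bsym _ w) linearZ. Qed.

Lemma inner_oppl v w : B (- v) w = - B v w.
Proof. by rewrite !(Bsym _ w) linearN. Qed.

Lemma inner_scaler a v w : B v (a *: w) = a * B v w.
Proof. by rewrite linearZ. Qed.

Lemma inner_sqrD v u : B (v + u) (v + u) = B v v + 2 * B v u + B u u.
Proof. by rewrite linearD/= !inner_addl (Bsym u v); ring. Qed.

Lemma inner_CS v w : B v w ^+ 2 <= B v v * B w w.
Proof.
have [w0|w0] := eqVneq (B w w) 0.
  have -> : w = 0.
    apply/eqP; have := le_B w; rewrite w0 mulr0 => w2.
    by rewrite -normr_eq0 -sqrf_eq0 eq_le w2 sqr_ge0.
  by rewrite !linear0 expr0n mulr0.
have {w0} w0 : 0 < B w w by rewrite lt_neqAle eq_sym w0 inner_ge0.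
have := inner_ge0 (v + - (B v w / B w w) *: w).
rewrite inner_sqrD inner_scalel !inner_scaler.
have -> : B v v + 2 * (- (B v w / B w w) * B v w) +
   - (B v w / B w w) * (- (B v w / B w w) * B w w) = B v v - B v w ^+ 2 / B w w.
  by field; rewrite gt_eqF.
by rewrite subr_ge0 ler_pdivrMr.
Qed.

Definition enorm v := Num.sqrt (B v v).

Lemma enorm_ge0 v : 0 <= enorm v. Proof. exact: sqrtr_ge0. Qed.

Lemma enorm_sqr v : enorm v ^+ 2 = B v v.
Proof. by rewrite sqr_sqrtr// inner_ge0. Qed.

Lemma enorm_le v : enorm v <= C * `|v|.
Proof.
rewrite -(@ler_pXn2r _ 2) ?nnegrE ?enorm_ge0 ?mulr_ge0 ?(ltW C0)//.
by rewrite enorm_sqr.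
Qed.

Lemma le_enorm v : `|v| <= C * enorm v.
Proof.
rewrite -(@ler_pXn2r _ 2) ?nnegrE ?mulr_ge0 ?enorm_ge0 ?(ltW C0)//.
by rewrite exprMn enorm_sqr.
Qed.

Lemma inner_norm_le v w : `|B v w| <= enorm v * enorm w.
Proof.
rewrite -(@ler_pXn2r _ 2) ?nnegrE ?mulr_ge0 ?enorm_ge0//.
by rewrite exprMn !enorm_sqr real_normK ?num_real// inner_CS.
Qed.

Lemma inner_le v w : `|B v w| <= enorm v * C * `|w|.
Proof.
by rewrite (le_trans (inner_norm_le _ _))// -mulrA ler_wpM2l ?enorm_ge0 ?enorm_le.
Qed.

Lemma enormZ a v : enorm (a *: v) = `|a| * enorm v.
Proof.
by rewrite /enorm inner_scalel inner_scaler mulrA -expr2 sqrtrM ?sqr_ge0// sqrtr_sqr.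
Qed.

Definition smooth_norm s v := Num.sqrt (B v v + s ^+ 2).

Section Smooth.
Variables (s : R) (s0 : 0 < s).
Local Notation h := (smooth_norm s).

Lemma smooth_norm_sqr v : h v ^+ 2 = B v v + s ^+ 2.
Proof. by rewrite sqr_sqrtr// addr_ge0 ?inner_ge0 ?sqr_ge0. Qed.

Lemma smooth_norm_gt0 v : 0 < h v.
Proof. by rewrite sqrtr_gt0 ltr_wpDl ?inner_ge0 ?exprn_gt0. Qed.

Lemma enorm_le_smooth v : enorm v <= h v.
Proof. by rewrite ler_wsqrtr// lerDl sqr_ge0. Qed.

Lemma smooth_norm0 : h 0 = s.
Proof. by rewrite /smooth_norm linear0 add0r sqrtr_sqr gtr0_norm. Qed.

(* The square root lies below its tangents. *)
Lemma smooth_norm_tangent v u :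
  h (v + u) <= h v + (2 * B v u + B u u) / (2 * h v).
Proof.
have hv := smooth_norm_gt0 v; have hu := smooth_norm_gt0 (v + u).
have -> : 2 * B v u + B u u = h (v + u) ^+ 2 - h v ^+ 2.
  by rewrite !smooth_norm_sqr inner_sqrD; ring.
rewrite -lerBlDl ler_pdivlMr ?mulr_gt0//.
have := sqr_ge0 (h (v + u) - h v); nra.
Qed.

(** With [w = u - v], Cauchy-Schwarz and [enorm v <= h v] give
    [h (v + w) ^+ 2 <= (h v + enorm w) ^+ 2]. *)
Lemma smooth_norm_lipschitz u v : h u <= h v + C * `|u - v|.
Proof.
have -> : u = v + (u - v) by rewrite addrC subrK.
move: (u - v) => w; rewrite [v + w - v]addrAC subrr add0r.
apply: (@le_trans _ _ (h v + enorm w)); last by rewrite lerD2l enorm_le.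
have hv := smooth_norm_gt0 v; have hw := enorm_ge0 w.
rewrite -(@ler_pXn2r _ 2) ?nnegrE ?addr_ge0 ?sqrtr_ge0//.
rewrite smooth_norm_sqr inner_sqrD sqrrD smooth_norm_sqr enorm_sqr.
have := le_trans (ler_norm _) (inner_norm_le v w).
have := ler_wpM2r hw (enorm_le_smooth v); rewrite mulr2n; lra.
Qed.

Lemma smooth_norm_continuous : continuous h.
Proof. exact: (lipschitz_continuous _ _ _ C smooth_norm_lipschitz). Qed.

End Smooth.

(** * Minimisation of the penalised function and its stationarity conditions *)

Hypothesis ballc : forall (x : V) r, compact [set y : V | `|y - x| <= r].
Variables (m : nat) (A : 'I_m -> set V) (x : V) (f : {linear V -> R^o}).
Hypotheses (Acl : forall i, closed (A i)) (Ax : forall i, A i x).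
Hypothesis f2 : forall v, `|f v| <= 2 * `|v|.
Local Notation h := smooth_norm.
Local Notation E := enorm.

Definition penalized (K e s : R) (y : V) (a : 'I_m -> V) : R :=
  - (f (y - x) : R) + K * (\sum_i h s (y - a i)) + e * h s (y - x).

Lemma penalized_minimum (K e s bt : R) : 0 < s -> 0 <= bt ->
  exists (y : V) (a : 'I_m -> V),
   [/\ `|y - x| <= bt, forall i, A i (a i) /\ `|a i - x| <= bt &
     forall y' a', `|y' - x| <= bt -> (forall i, A i (a' i) /\ `|a' i - x| <= bt) ->
      penalized K e s y a <= penalized K e s y' a'].
Proof.
move=> s0 bt0.
(* The tuple is stored as one point of a product, with [None] the index of [y] and [Some i] that of
   [a i], so that Tychonoff's theorem gives compactness of the constraint set. *)
pose T := prod_topology (fun _ : option 'I_m => V).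
pose bl := [set y : V | `|y - x| <= bt].
pose D (o : option 'I_m) := if o is Some i then A i `&` bl else bl.
pose S : set T := [set z | forall o, D o (z o)].
have Sc : compact S.
  apply: tychonoff => -[i|]; last exact: ballc.
  rewrite /D setIC; apply: compact_closedI => //; exact: ballc.
have pc o : continuous (fun z : T => z o) by exact: proj_continuous.
have hc := smooth_norm_continuous s s0.
have fc : continuous (f : V -> R).
  apply: (lipschitz_continuous _ _ _ 2) => u v.
  rewrite -lerBlDl; have := le_trans (ler_norm _) (f2 (u - v)).
  by rewrite linearB.
pose Phi (z : T) := penalized K e s (z None) (fun i => z (Some i)).
have xc : continuous (fun _ : T => x) by exact: cst_continuous.
have Phic : continuous Phi.
  apply: (continuous_combination R T m (fun z => f (z None - x))
    (fun z => h s (z None - x)) (fun i z => h s (z None - z (Some i)))).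
  - exact: (continuous_compB R V T _ _ _ (pc None) xc fc).
  - exact: (continuous_compB R V T _ _ _ (pc None) xc hc).
  - move=> i; exact: (continuous_compB R V T _ _ _ (pc None) (pc (Some i)) hc).
have [||z zS zmin] := @compact_EVT_min T R Phi S _ Sc.
- by exists (fun=> x) => -[i|] /=; rewrite /bl /= subrr normr0.
- exact: continuous_subspaceT.
rewrite inE in zS; exists (z None), (fun i => z (Some i)); split.
- exact: (zS None).
- by move=> i; have [] := zS (Some i).
- move=> y' a' y'bt a'P.
  apply: (zmin (fun o => if o is Some i then a' i else y')).
  by rewrite inE => -[i|] //=; apply: a'P.
Qed.

(** Moving a single [a i] inside [A i] gives the proximal inequality for [w i]; moving [y] in an
    arbitrary direction gives the approximate decomposition of [f]. Both moves are admissible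
    because the minimiser lies well inside the balls of radius [bt]. *)
Lemma approximate_multipliers (tau r rho eps : R) :
  0 <= tau -> 0 < r -> 0 < rho -> 0 < eps <= 1 ->
  (forall y, `|y - x| < r ->
     dist_to y (\bigcap_i A i) <= tau * \sum_(i < m) dist_to y (A i)) ->
  (forall z, (\bigcap_i A i) z -> `|z - x| < rho ->
     f (z - x) <= eps * `|z - x|) ->
  exists (a w : 'I_m -> V),
  [/\ forall i, A i (a i), forall i, `|a i - x| <= eps,
      forall i, E (w i) <= 3 * tau * C + 1,
      forall i, exists M d : R, 0 < d /\ forall z, A i z -> `|z - a i| < d ->
        B (w i) (z - a i) <= M * `|z - a i| ^+ 2 &
      forall u, `|(f u : R) - \sum_i (B (w i) u : R)| <= eps * (C + 1) * C * `|u|].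
Proof.
move=> tau0 r0 rho0 /andP[eps0 eps1] subt fn.
(* Passing from the given norm to [E] multiplies the penalty constants by [C]. The excesses [1] and
   [eps] beyond [3 * tau * C] and [eps * C] yield the growth in [pen], which localises the
   minimiser. *)
set K := 3 * tau * C + 1; pose e := eps * (C + 1).
have K0 : 0 < K by rewrite ltr_wpDl// !mulr_ge0// ltW.
have e0 : 0 < e by rewrite mulr_gt0// addr_gt0.
have le_E := le_enorm.
have E_le := enorm_le.
have pen (y : V) (a : 'I_m -> V) : `|y - x| < r -> 2 * `|y - x| < rho ->
    (forall i, A i (a i)) ->
    \sum_i E (y - a i) + eps * E (y - x) <=
    - (f (y - x) : R) + K * (\sum_i E (y - a i)) + e * E (y - x).
  move=> yr yrho Aa.
  have := subtransversal_penalty _ _ _ A x f tau r rho eps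
    (fun i _ => Ax i) tau0 _ subt f2 fn y a yr yrho Aa.
  rewrite (ltW eps0) eps1 => /(_ isT).
  have : 3 * tau * \sum_i `|y - a i| <= 3 * tau * (C * \sum_i E (y - a i)).
    rewrite ler_wpM2l ?mulr_ge0// mulr_sumr.
    by apply: ler_sum => i _; exact: le_E.
  have : eps * `|y - x| <= eps * (C * E (y - x)).
    by rewrite ler_pM2l.
  rewrite /K /e; move: (f _ : R) (\sum_i _) (\sum_i _) => fy S1 S2; lra.
(* The three bounds serve, in order, [|a i - x| <= eps], the radius of subtransversality, and the
   condition [2 * |y - x| < rho] of the penalty estimate. *)
pose bt := Num.min eps (Num.min (r / 2) (rho / 4)).
have bt0 : 0 < bt by rewrite !lt_min eps0 !divr_gt0.
have bt_eps : bt <= eps by rewrite ge_min lexx.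
have bt_r : bt <= r / 2 by rewrite !ge_min lexx orbT.
have bt_rho : bt <= rho / 4 by rewrite !ge_min lexx !orbT.
pose T := K * m%:R + e.
have T0 : 0 < T by rewrite ltr_wpDl// mulr_ge0// ltW.
(* The smoothed function has value [T * s] at [(x, ..., x)], and this [s] makes [C * (T * s)] equal
   to [bt * eps / 4]. The factor [eps] is needed because the growth in [y - x] has weight only
   [eps]. *)
pose s := bt * eps / (4 * C * T).
have s0 : 0 < s by rewrite divr_gt0 ?mulr_gt0.
have [y [a [ybt aP amin]]] := penalized_minimum K e s bt s0 (ltW bt0).
have h0 v : 0 < h s v := smooth_norm_gt0 s s0 v.
have Eh v : E v <= h s v := enorm_le_smooth s v.
have Ege v : 0 <= E v := enorm_ge0 v.
have small : \sum_i E (y - a i) + eps * E (y - x) <= T * s.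
  have := amin x (fun=> x).
  rewrite subrr normr0 (ltW bt0) => /(_ isT (fun i => conj (Ax i) isT)).
  rewrite [leRHS]/penalized subrr linear0 oppr0 add0r.
  rewrite (smooth_norm0 s s0) sumr_const card_ord -[s *+ m]mulr_natl mulrA -mulrDl.
  apply: le_trans.
  have yr : `|y - x| < r by lra.
  have yrho : 2 * `|y - x| < rho by lra.
  rewrite (le_trans (pen y a yr yrho (fun i => proj1 (aP i))))//.
  rewrite lerD// ?ler_pM2l// lerD2l ler_pM2l//.
  by apply: ler_sum => i _.
have TsE : C * (T * s) = bt * eps / 4.
  by rewrite /s; field; rewrite !gt_eqF.
have ai_y i : `|y - a i| <= bt / 4.
  rewrite (le_trans (le_E _))// (@le_trans _ _ (C * (T * s)))//.
    rewrite ler_pM2l// (le_trans _ small)// (bigD1 i)//= -addrA lerDl.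
    by rewrite addr_ge0 ?sumr_ge0// mulr_ge0// ltW.
  by rewrite TsE ler_pM2r ?invr_gt0// ler_piMr// ltW.
have y_x : `|y - x| <= bt / 4.
  rewrite (le_trans (le_E _))// -(@ler_pM2l _ eps)// mulrCA.
  rewrite (@le_trans _ _ (C * (T * s)))//.
    by rewrite ler_pM2l// (le_trans _ small)// lerDr sumr_ge0.
  by rewrite TsE mulrA (mulrC eps).
have ai_x i : `|a i - x| <= bt / 2.
  have := ler_distD y (a i) x; rewrite (distrC (a i) y).
  by have := ai_y i; lra.
have tangent v u : h s (v + u) <= h s v + (2 * B v u + B u u) / (2 * h s v) :=
  smooth_norm_tangent s s0 v u.
pose w i := (K / h s (y - a i)) *: (y - a i).
exists a, w; split.
- by move=> i; have [] := aP i.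
- by move=> i; have := ai_x i; lra.
- move=> i; rewrite enormZ ger0_norm ?divr_ge0 ?(ltW K0) ?(ltW (h0 _))//.
  by rewrite mulrAC ler_pdivrMr// ler_pM2l.
(* Only [a i] is changed, to [z]; the radius [bt / 2] keeps [z] in the ball. Minimality and the
   tangent bound for [h s (y - z)] give [2 * B (y - a i) (z - a i) <= B (z - a i) (z - a i)]. *)
- move=> i; exists (K * C ^+ 2 / (2 * h s (y - a i))), (bt / 2).
  split=> [|z Az zai]; first by rewrite divr_gt0.
  have zx : `|z - x| <= bt.
    by have := ler_distD (a i) z x; have := ai_x i; lra.
  pose a' j := if j == i then z else a j.
  have := amin y a' ybt; have a'P j : A j (a' j) /\ `|a' j - x| <= bt.
    by rewrite /a'; case: eqP => [->|_].
  move=> /(_ a'P); rewrite /penalized lerD2r lerD2l ler_pM2l//.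
  rewrite (bigD1 i)//= [leRHS](bigD1 i)//= {1}/a' eqxx.
  rewrite (eq_bigr (fun j => h s (y - a' j))); last first.
    by move=> j ji; rewrite /a' (negPf ji).
  rewrite lerD2r => hle.
  have yz : y - z = (y - a i) + - (z - a i) by rewrite opprB addrA subrK.
  move: hle; rewrite yz => /le_trans/(_ (tangent _ _)).
  rewrite lerDl pmulr_lge0 ?invr_gt0 ?mulr_gt0// linearN/= linearN/= inner_oppl opprK.
  move=> hle; rewrite inner_scalel.
  have : 2 * B (y - a i) (z - a i) <= C ^+ 2 * `|z - a i| ^+ 2.
    have := B_le (z - a i); rewrite exprMn.
    move: (_ * _ ^+ 2) (B _ _) (B _ _) hle => F1 F2 F3; lra.
  have := h0 (y - a i); set H := h s _; set b := B _ _ => H0 hb.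
  have -> : K / H * b = K / (2 * H) * (2 * b) by field; rewrite gt_eqF.
  have -> : K * C ^+ 2 / (2 * H) * `|z - a i| ^+ 2 =
      K / (2 * H) * (C ^+ 2 * `|z - a i| ^+ 2).
    by field; rewrite gt_eqF.
  by rewrite ler_pM2l// divr_gt0// mulr_gt0.
- have fo u : (f u : R) <= \sum_i (B (w i) u : R) + e * B (y - x) u / h s (y - x).
    (* [S] collects the second-order coefficients of the tangent bounds along [y + t *: u]. After
       division by [t] they contribute [t * Q], which the choice of [t] makes at most [eta]; the
       other bound on [t] keeps [y + t *: u] in the ball. *)
    pose S := K * \sum_i (2 * h s (y - a i))^-1 + e / (2 * h s (y - x)).
    have S0 : 0 <= S.
      apply: addr_ge0; last by apply: divr_ge0; [exact: ltW|rewrite mulr_ge0// ltW].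
      apply: mulr_ge0; first exact: ltW.
      by apply: sumr_ge0 => i _; rewrite invr_ge0 mulr_ge0// ltW.
    pose Q := S * B u u.
    have Q0 : 0 <= Q by apply: mulr_ge0 => //; exact: inner_ge0.
    apply/ler_addgt0Pr => eta eta0.
    have [Q1 u1] : 0 < Q + 1 /\ 0 < `|u| + 1 by split; rewrite ltr_wpDl.
    pose t := Num.min (bt / 2 / (`|u| + 1)) (eta / (Q + 1)).
    have t0 : 0 < t by rewrite lt_min !divr_gt0.
    have tu : t * `|u| <= bt / 2.
      rewrite (@le_trans _ _ (t * (`|u| + 1)))//; first by rewrite ler_pM2l// lerDl.
      by rewrite -ler_pdivlMr// ge_min lexx.
    have tQ : t * Q <= eta.
      rewrite (@le_trans _ _ (t * (Q + 1)))//; first by rewrite ler_pM2l// lerDl.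
      by rewrite -ler_pdivlMr// ge_min lexx orbT.
    have ytu : `|y + t *: u - x| <= bt.
      rewrite addrAC (le_trans (ler_normD _ _))// normrZ gtr0_norm//; lra.
    have tan v : h s (v + t *: u) <=
        h s v + t * (B v u / h s v + t * B u u * (2 * h s v)^-1).
      rewrite (le_trans (tangent _ _))// !inner_scaler inner_scalel lerD2l le_eqVlt.
      by apply/orP; left; apply/eqP; field; rewrite gt_eqF.
    have := amin (y + t *: u) a ytu aP.
    rewrite /penalized.
    have -> : f (y + t *: u - x) = (f (y - x) + t * f u : R).
      by rewrite [y + t *: u - x]addrAC linearD; congr (_ + _); exact: linearZ.
    rewrite [y + t *: u - x]addrAC.
    have : K * \sum_i h s (y + t *: u - a i) <= K * \sum_i h s (y - a i) +
        t * (\sum_i (B (w i) u : R) + t * B u u * (K * \sum_i (2 * h s (y - a i))^-1)).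
      have -> : \sum_i (B (w i) u : R) = K * \sum_i B (y - a i) u / h s (y - a i).
        by rewrite mulr_sumr; apply: eq_bigr => i _; rewrite inner_scalel mulrAC -mulrA.
      rewrite mulrCA -mulrDr mulrCA -mulrDr ler_pM2l// mulr_sumr -big_split/=.
      rewrite mulr_sumr -big_split/=; apply: ler_sum => i _.
      by rewrite [y + t *: u - a i]addrAC.
    have := ler_wpM2l (ltW e0) (tan (y - x)).
    set G := \sum_i (B (w i) u : R); set P := \sum_i (2 * _)^-1.
    set b := B (y - x) u; set H := h s (y - x); set q := B u u.
    move=> h1 h2 h3; rewrite -(ler_pM2l t0).
    have QE : t * (G + e * b / H + t * Q) =
        t * (G + t * q * (K * P)) + e * (t * (b / H + t * q / (2 * H))).
      by rewrite /Q /S -/P -/q -/H; ring.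
    have : t * (G + e * b / H + t * Q) <= t * (G + e * b / H + eta).
      by rewrite ler_pM2l// lerD2l.
    rewrite {}QE; move: h1 h2 h3; rewrite mulrDr.
    move: (t * (_ + eta)) (t * (_ + _ * (K * P))).
    move: (t * f u : R) (f (y - x) : R) => F3 F4 F1 F2.
    move: (K * _) (K * _) (e * h s _) (e * H) (e * (t * _)) => F5 F6 F7 F8 F9; lra.
  have bxu v : e * B (y - x) v / h s (y - x) <= e * C * `|v|.
    rewrite -mulrA -[leRHS]mulrA ler_pM2l// ler_pdivrMr//.
    apply: (le_trans (le_trans (ler_norm _) (inner_le _ _))).
    by rewrite -mulrA mulrC ler_wpM2l ?mulr_ge0 ?(ltW C0).
  have fo' v : (f v : R) <= \sum_i (B (w i) v : R) + e * C * `|v|.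
    by rewrite (le_trans (fo v))// lerD2l.
  (* Linearity turns the one-sided estimate at [- u] into the missing lower bound at [u]. *)
  move=> u; have := fo' (- u); rewrite normrN.
  have -> : f (- u) = (- f u : R) by exact: linearN.
  have -> : \sum_i (B (w i) (- u) : R) = - \sum_i (B (w i) u : R).
    by rewrite -sumrN; apply: eq_bigr => i _; rewrite linearN.
  have := fo' u; rewrite ler_norml -/e.
  move: (f u : R) (\sum_i _) => F1 F2 hu hNu; apply/andP; split; lra.
Qed.
End Inner.

(** * Normals, functionals and subsequences *)

Section Normals.
Context (R : realType) (V : normedModType R).

Lemma linear_bundle (f : V -> R^o) : linear f ->
  exists g : {linear V -> R^o}, f = g.
Proof.
move=> flin.
by exists (HB.pack f (GRing.isLinear.Build _ _ _ _ _ flin) : {linear V -> R^o}).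
Qed.

Lemma dual_of_bound (g : {linear V -> R^o}) (N : R) :
  (forall v, `|g v| <= N * `|v|) -> dual g.
Proof.
move=> gN; split; first exact: linearP.
apply: (lipschitz_continuous _ _ (g : V -> R) N) => u v.
rewrite -lerBlDl; have := le_trans (ler_norm _) (gN (u - v)).
by rewrite linearB.
Qed.

(** Proximal normals are Fréchet normals: divided by [|z - a|], the quadratic bound tends to 0. *)
Lemma proximal_eps_normals (A : set V) (a : V) (g : {linear V -> R^o}) (N M d : R) :
  (forall v, `|g v| <= N * `|v|) -> 0 < d ->
  (forall z, A z -> `|z - a| < d -> g (z - a) <= M * `|z - a| ^+ 2) ->
  eps_normals 0 A a g.
Proof.
move=> gN d0 gM; split; first exact: dual_of_bound gN.
apply/lee_addgt0Pr => eta eta0; rewrite add0e.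
have M0 : 0 < `|M| + 1 by rewrite ltr_wpDl.
pose S := [set y : V | g (y - a) / `|y - a| <= eta].
(* The upper limit is an infimum of suprema over the members of the filter; [S] is such a member. *)
apply: (@le_trans _ _ (ereal_sup ((fun y : V => (g (y - a) / `|y - a|)%:E) @` S))).
  apply: ereal_inf_lbound; exists S => //.
  rewrite /within/=; near=> y => Ay; rewrite /S/=.
  have ya : y != a by near: y; exact: nbhs_dnbhs_neq.
  have ya0 : 0 < `|y - a| by rewrite normr_gt0 subr_eq0.
  have yd : `|y - a| < Num.min d (eta / (`|M| + 1)).
    rewrite distrC; near: y; apply: nbhs_dnbhs.
    have := nbhsx_ballx a (Num.min d (eta / (`|M| + 1))).
    by rewrite lt_min d0 divr_gt0//= -ball_normE => /(_ isT).
  move: yd; rewrite lt_min ltr_pdivlMr// => /andP[yd yeta].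
  rewrite ler_pdivrMr// (le_trans (gM _ Ay yd))// expr2 mulrA ler_pM2r//.
  apply: le_trans (ltW yeta); rewrite mulrC ler_pM2l// (le_trans (ler_norm M))//.
  by rewrite lerDl.
by apply: ge_ereal_sup => _ [y Sy <-]; rewrite lee_fin.
Unshelve. all: by end_near. Qed.

(** The gap between [eps] and [e] provides a punctured neighbourhood on which the quotient stays
    below [e]; at the centre both sides vanish. *)
Lemma eps_normals_le (A : set V) (x : V) (g : V -> R^o) (eps e : R) :
  eps_normals eps A x g -> eps < e ->
  exists2 rho, 0 < rho &
    forall z, A z -> `|z - x| < rho -> g (z - x) <= e * `|z - x|.
Proof.
move=> [[/linear_bundle[{}g ->] _] gn] epse.
have /ereal_inf_lt[_ [S FS <-] Se] := le_lt_trans gn (etrans (lte_fin _ _) epse).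
have : nbhs x [set y | y != x -> A y -> S y] by exact: FS.
move=> /nbhs_ballP[rho/= rho0 rhoS]; exists rho => // z Az zx.
have [->|zneqx] := eqVneq z x.
  by rewrite subrr linear0 normr0 mulr0.
rewrite -ler_pdivrMr ?normr_gt0 ?subr_eq0// -lee_fin (le_trans _ (ltW Se))//.
apply: ereal_sup_ubound; exists z => //; apply: rhoS => //.
by rewrite -ball_normE /= distrC.
Qed.

Lemma dual_unit_ball_le (f : V -> R^o) : dual_unit_ball f ->
  forall v, `|f v| <= `|v|.
Proof.
move=> [[/linear_bundle[{}f ->] _] f1] v.
have [->|v0] := eqVneq v 0; first by rewrite linear0 !normr0.
have v0' : 0 < `|v| by rewrite normr_gt0.
have : (`|f (`|v|^-1 *: v)|%:E <= 1)%E.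
  apply: le_trans f1; apply: ereal_sup_ubound; exists (`|v|^-1 *: v) => //=.
  by rewrite normrZ ger0_norm ?invr_ge0// mulVf ?gt_eqF.
rewrite linearZ.
by rewrite lee_fin normrM ger0_norm ?invr_ge0// ler_pdivrMl// mulr1.
Qed.

Lemma dual_unit_ballP (g : {linear V -> R^o}) :
  (forall v, `|g v| <= `|v|) -> dual_unit_ball g.
Proof.
move=> g1; split; first by apply: (dual_of_bound g 1) => v; rewrite mul1r.
apply: ge_ereal_sup => _ [v /= v1 <-]; rewrite lee_fin.
exact: le_trans (g1 v) v1.
Qed.

(** Pointwise convergence at the finitely many spanning vectors already controls the dual norm,
    because the coordinates are bounded. *)
Lemma weak_star_cvg_uniform (fs : nat -> V -> R^o) (f : V -> R^o) (eta : R) :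
  finite_dimensional V -> (forall n, linear (fs n)) -> linear f ->
  weak_star_cvg fs f -> 0 < eta ->
  \forall n \near \oo, forall v, `|fs n v - f v| <= eta * `|v|.
Proof.
move=> /bounded_coordinates[d [e [c [C [C0 vE cC]]]]] fslin flin fsf eta0.
have P0 : 0 < C * d.+1%:R by rewrite mulr_gt0.
have : \forall n \near \oo, forall i : 'I_d,
    `|fs n (e i) - f (e i)| < eta / (C * d.+1%:R).
  apply: filter_forall => i.
  have /cvgrPdist_lt/(_ _ (divr_gt0 eta0 P0)) := fsf (e i).
  by apply: filterS => n; rewrite distrC.
apply: filterS => n ne v.
have [fl flE] := linear_bundle _ flin.
have [g gE] := linear_bundle _ (fslin n).
have -> : fs n v - f v = \sum_i c i v * (fs n (e i) - f (e i)).
  rewrite gE flE {1 2}(vE v) (linear_sum g) (linear_sum fl) -sumrB.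
  apply: eq_bigr => i _; rewrite mulrBr; congr (_ - _); exact: linearZ.
rewrite (le_trans (ler_norm_sum _ _ _))//.
rewrite (@le_trans _ _ (\sum_(i < d) C * `|v| * (eta / (C * d.+1%:R))))//.
  by apply: ler_sum => i _; rewrite normrM ler_pM// ltW.
rewrite sumr_const card_ord -[leLHS]mulr_natr.
have -> : C * `|v| * (eta / (C * d.+1%:R)) * d%:R = eta * `|v| * (d%:R / d.+1%:R).
  by field; rewrite gt_eqF//= gt_eqF.
rewrite ler_piMr ?mulr_ge0 ?(ltW eta0)// ler_pdivrMr// mul1r ler_nat; exact: leqnSn.
Qed.

Lemma cvg_of_harmonic (u : nat -> V) (l : V) (M : R) :
  (forall k, `|u k - l| <= M / k.+1%:R) -> u @ \oo --> l.
Proof.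
move=> uM; apply/cvgrPdist_le => eps eps0.
have /cvgrPdist_le/(_ _ eps0) : (fun k => M / k.+1%:R) @ \oo --> (0 : R).
  rewrite -(mulr0 M); exact: (cvgM (cvg_cst _) cvg_harmonic).
apply: filterS => k; rewrite sub0r normrN distrC; apply: le_trans.
by rewrite (le_trans (uM k))// ler_norm.
Qed.

(** A cluster point in the product space serves all indices [i] at once. The selection [s] is not
    claimed to be monotone: [k <= s k] and the explicit rate suffice for the limits taken later. *)
Lemma cluster_subsequence m (r : R) (W : nat -> 'I_m -> V) :
  finite_dimensional V -> (forall n i, `|W n i| <= r) ->
  exists (w : 'I_m -> V) (s : nat -> nat),
    [/\ forall i, `|w i| <= r, forall k, (k <= s k)%N &
        forall k i, `|W (s k) i - w i| <= k.+1%:R^-1].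
Proof.
move=> Vfin Wr.
pose D := [set y : V | `|y - 0| <= r].
pose T := prod_topology (fun _ : 'I_m => V).
pose S : set T := [set z | forall i, D (z i)].
have Sc : compact S.
  apply: (@tychonoff 'I_m (fun=> V) (fun=> D)) => i.
  apply: (closed_ball_compact _ _ 0 r Vfin).
have [|w [Sw wcl]] := Sc (W @ \oo) _.
  by exists 0%N => // n _ i; rewrite /D/= subr0.
have ex k : exists n, (k <= n)%N /\ forall i, `|W n i - w i| <= k.+1%:R^-1.
  have /wcl : (W @ \oo) [set W n | n in [set n | (k <= n)%N]].
    by exists k => // n /= kn; exists n.
  have k0 : 0 < k.+1%:R^-1 :> R by rewrite invr_gt0.
  have wi (i : 'I_m) : nbhs (w : T) [set z : T | `|z i - w i| <= k.+1%:R^-1].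
    have pc : continuous (fun z : T => z i) by exact: proj_continuous.
    have /cvgrPdist_le/(_ _ k0) := pc w.
    by under [X in nbhs _ X -> _]eq_set do rewrite distrC.
  have : nbhs (w : T) [set z : T | forall i, `|z i - w i| <= k.+1%:R^-1].
    exact: (@filter_forall T _ (fun i z => `|z i - w i| <= k.+1%:R^-1) _
      (nbhs_filter _) wi).
  by move=> wn /(_ _ wn)[_ [[n kn <-] nw]]; exists n.
have [s sP] := choice ex.
exists w, s; split.
- by move=> i; have := Sw i; rewrite /D/= subr0.
- by move=> k; have [] := sP k.
- by move=> k; have [] := sP k.
Qed.

End Normals.

(** * Limiting normals of the intersection *)

Theorem theorem3p3 (R : realType) (V : normedModType R) (m : nat)
    (A : 'I_m -> set V) (xbar : V)
    (Vfin : finite_dimensional V)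
    (Aclosed : forall i, closed (A i))
    (Axbar : (\bigcap_i A i) xbar)
    (Asub : subtransversal A xbar) :
  exists tau delta : R, [/\ 0 < tau, 0 < delta &
    forall x : V, (ball xbar delta `&` \bigcap_i A i) x ->
      limiting_normals (\bigcap_i A i) x `&` dual_unit_ball `<=`
      scale_set tau
        (minkowski_sum (fun i : 'I_m => limiting_normals (A i) x `&` dual_unit_ball))].
Proof.
have [tau0 [r [tau0_gt0 r0 subt]]] := Asub.
have [B [C [C0 Bsym B_le le_B]]] := exists_inner_product _ _ Vfin.
have ballc (x : V) r' := closed_ball_compact _ _ x r' Vfin.
pose K := 3 * tau0 * C + 1.
have K0 : 0 < K by rewrite ltr_wpDl// !mulr_ge0// ltW.
(* The multipliers satisfy [|w i| <= C * K], so division by [tau] brings them below [C ^- 2]. By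
   [B_norm] the functionals they represent then lie in the dual unit ball. *)
pose tau := K * C ^+ 3.
have tau_gt0 : 0 < tau by rewrite mulr_gt0// exprn_gt0.
have r2 : 0 < r / 2 by rewrite divr_gt0.
have B_norm w v : `|B w v| <= C ^+ 2 * `|w| * `|v|.
  rewrite (le_trans (inner_le _ _ _ _ C0 Bsym B_le le_B w v))// ler_wpM2r//.
  rewrite expr2 -mulrA mulrC ler_pM2l//.
  exact: (enorm_le _ _ _ _ C0 Bsym B_le le_B).
(* The remaining [r / 2] is shared equally: [xs n] is taken within [r / 4] of [x], and the penalty
   estimate is used within [r / 4] of [xs n]. *)
exists tau, (r / 2); split=> // x [xball Ax] f.
move=> [[fdual [xs [es [fs [[xsA xsx] [es0 escvg] fsf fsn]]]]] f1].
have [fl flE] := linear_bundle _ _ _ fdual.1.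
have fslin n : linear (fs n) by have [[]] := fsn n.
have f_le := dual_unit_ball_le _ _ _ f1.
have approx (eta : R) : 0 < eta <= 1 -> exists (a W : 'I_m -> V),
    [/\ forall i, A i (a i), forall i, `|a i - x| <= eta,
        forall i, `|W i| <= C ^- 2,
        forall i, eps_normals 0 (A i) (a i) (B (W i)) &
        forall u, `|(f u : R) - tau * \sum_i (B (W i) u : R)| <= eta * `|u|].
  move=> /andP[eta0 eta1].
  (* The first bound splits [|a i - x|] through [xs n]. The second makes the multiplier error at
     most half of [eta], the other half being spent on [fs n - f]. *)
  pose e := Num.min (eta / 2) (eta / (2 * (C + 1) * C)).
  have C1 : 0 < (C + 1) * C by rewrite mulr_gt0// addr_gt0.
  have e0 : 0 < e by rewrite lt_min !divr_gt0// -mulrA mulr_gt0.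
  have e_eta : e <= eta / 2 by rewrite ge_min lexx.
  have eC : e * (C + 1) * C <= eta / 2.
    rewrite -mulrA -ler_pdivlMr// ge_min; apply/orP; right.
    by rewrite le_eqVlt; apply/orP; left; apply/eqP; field; rewrite !gt_eqF ?addr_gt0.
  have er : 0 < Num.min e (r / 4) by rewrite lt_min e0 divr_gt0.
  have unif : \forall n \near \oo, forall v, `|fs n v - f v| <= eta / 2 * `|v|.
    by apply: weak_star_cvg_uniform => //; [exact: fdual.1|exact: divr_gt0].
  have xsn : \forall n \near \oo, `|x - xs n| < Num.min e (r / 4).
    by move/cvgrPdist_lt : xsx => /(_ _ er).
  have esn : \forall n \near \oo, `|0 - es n| < e.
    by move/cvgrPdist_lt : escvg => /(_ _ e0).
  have [n [fn [xn en]]] := filter_ex (filterI unif (filterI xsn esn)).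
  move: xn; rewrite lt_min distrC => /andP[xne xnr].
  have {}en : es n < e by rewrite (le_lt_trans (ler_norm _))// -normrN -sub0r.
  have [g gE] := linear_bundle _ _ _ (fslin n).
  (* The functionals [fs n] carry no norm bound of their own; near the limit [f] in the unit ball
     their norm is at most [1 + eta / 2]. *)
  have g2 v : `|g v| <= 2 * `|v|.
    have := fn v; have := f_le v; rewrite gE => h1 h2.
    have := ler_normD (g v - f v) (f v); rewrite subrK.
    have : eta / 2 * `|v| <= 1 * `|v| by rewrite ler_wpM2r//; lra.
    by rewrite mul1r; lra.
  have [rho rho0 gn] := eps_normals_le _ _ _ _ _ _ _ (fsn n) en.
  have [||||a [w [wA wx wE wn wf]]] :=
    approximate_multipliers R V B C C0 Bsym B_le le_B ballc m A (xs n) g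
    Aclosed (fun i => xsA n i I) g2 tau0 (r / 4) rho e (ltW tau0_gt0) _ rho0 _ _ _.
  - by rewrite divr_gt0.
  - by rewrite e0; lra.
  - move=> y yx; apply: subt; rewrite -ball_normE/=.
    move: xball; rewrite -ball_normE/= => xball.
    have := ler_distD x xbar y; have := ler_distD (xs n) x y.
    by rewrite (distrC x (xs n)) (distrC (xs n) y); lra.
  - by move=> z Az zx; have := gn z Az zx; rewrite gE.
  exists a, (fun i => tau^-1 *: w i); split=> //.
  - by move=> i; have := ler_distD (xs n) (a i) x; have := wx i; lra.
  - move=> i; rewrite normrZ gtr0_norm ?invr_gt0// ler_pdivrMl//.
    rewrite (le_trans (le_enorm _ _ _ _ C0 Bsym le_B (w i)))//.
    have -> : tau * C ^- 2 = C * K by rewrite /tau; field; rewrite gt_eqF.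
    by rewrite ler_pM2l.
  - move=> i; have [M [d [d0 wM]]] := wn i.
    apply: (proximal_eps_normals _ _ _ _ _
      (C ^+ 2 * `|tau^-1 *: w i|) (tau^-1 * M) d) => //.
    move=> z Az za; rewrite (inner_scalel _ _ _ Bsym) -mulrA ler_pM2l ?invr_gt0//.
    exact: wM.
  - move=> u.
    have -> : tau * \sum_i (B (tau^-1 *: w i) u : R) = \sum_i (B (w i) u : R).
      rewrite mulr_sumr; apply: eq_bigr => i _.
      by rewrite (inner_scalel _ _ _ Bsym) mulrA mulfV ?gt_eqF// mul1r.
    have := fn u; have := wf u; rewrite gE => h1 h2.
    have := ler_distD (g u : R) (f u : R) (\sum_i (B (w i) u : R)).
    have : e * (C + 1) * C * `|u| <= eta / 2 * `|u| by rewrite ler_wpM2r.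
    rewrite (distrC (f u : R) (g u : R)); lra.
have approx_inv n : exists p : ('I_m -> V) * ('I_m -> V),
    [/\ forall i, A i (p.1 i), forall i, `|p.1 i - x| <= n.+1%:R^-1,
        forall i, `|p.2 i| <= C ^- 2,
        forall i, eps_normals 0 (A i) (p.1 i) (B (p.2 i)) &
        forall u, `|(f u : R) - tau * \sum_i (B (p.2 i) u : R)| <= n.+1%:R^-1 * `|u|].
  have [|a [W aWP]] := approx n.+1%:R^-1; last by exists (a, W).
  by rewrite invr_gt0 ltr0n invf_le1// ler1n.
have [aW aWP] := choice approx_inv.
have [|w [s [w1 s_ge sw]]] := cluster_subsequence _ _ m (C ^- 2) (fun n => (aW n).2) Vfin.
  by move=> n i; have [_ _ ->] := aWP n.
have s_inv k : (s k).+1%:R^-1 <= k.+1%:R^-1 :> R.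
  by rewrite lef_pV2 ?posrE// ler_nat ltnS.
have Bw_le i v : `|B (w i) v| <= `|v|.
  rewrite (le_trans (B_norm _ _))// ler_piMl//.
  by rewrite -ler_pdivlMl ?exprn_gt0// mulr1.
have Bsw k i v : `|B ((aW (s k)).2 i) v - B (w i) v| <= C ^+ 2 * `|v| / k.+1%:R.
  rewrite -(inner_subl _ _ _ Bsym) (le_trans (B_norm _ _))//.
  by rewrite mulrAC ler_wpM2l// mulr_ge0// exprn_ge0// ltW.
exists (\sum_i (B (w i) : V -> R^o)).
  exists (fun i => (B (w i) : V -> R^o)) => // i; split; last exact: dual_unit_ballP.
  split; first by apply: (dual_of_bound _ _ _ 1) => v; rewrite mul1r.
  (* The approximating functionals are exact Fréchet normals at the points of [A i], so the
     tolerances may be identically 0. *)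
  exists (fun k => (aW (s k)).1 i), (fun=> 0), (fun k => B ((aW (s k)).2 i)); split.
  - split; first by move=> k; have [] := aWP (s k).
    apply: (cvg_of_harmonic _ _ _ _ 1) => k; rewrite mul1r.
    by have [_ /(_ i)/le_trans ->] := aWP (s k).
  - by split=> //; exact: cvg_cst.
  - move=> v; apply: (cvg_of_harmonic _ (R^o) _ _ (C ^+ 2 * `|v|)) => k; exact: Bsw.
  - by move=> k; have [] := aWP (s k).
apply/funext => v; rewrite /= fct_sumE.
pose c := `|v| + tau * (m%:R * (C ^+ 2 * `|v|)).
have fv k : `|(f v : R) - tau * \sum_i (B (w i) v : R)| <= c / k.+1%:R.
  have [_ _ _ _ /(_ v) h1] := aWP (s k).
  rewrite (le_trans (ler_distD (tau * \sum_i (B ((aW (s k)).2 i) v : R)) _ _))//.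
  rewrite /c mulrDl lerD//.
    by rewrite (le_trans h1)// mulrC ler_wpM2l.
  rewrite -mulrBr normrM (gtr0_norm tau_gt0) -[leRHS]mulrA ler_pM2l// -sumrB.
  rewrite (le_trans (ler_norm_sum _ _ _))// -mulrA.
  rewrite (@le_trans _ _ (\sum_(i < m) C ^+ 2 * `|v| / k.+1%:R))//.
    by apply: ler_sum => i _; exact: Bsw.
  by rewrite sumr_const card_ord -[leLHS]mulr_natl.
(* The constant sequence [f v] converges to the value of the scaled sum as well as to itself; limits
   are unique. *)
have /(cvg_of_harmonic R R^o (fun=> f v)) cv := fv.
have E := cvg_unique _ cv (cvg_cst (f v)).
exact: (E (@norm_hausdorff _ _)).
Qed.
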